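(* Let $n$ be a positive integer and $\pi$ a $(3,n)$-parking function with $\mathrm{pides}(\pi)=2^a1^b$ (so $n=2a+b$). Then $\mathbb{S}(\pi)$ is a $(3,a+2b)$-parking function; that is, the lattice path from $(0,0)$ to $(3,a+2b)$ whose number of north steps in column $x$ equals the number of cars $\mathbb{S}(\pi)$ places in column $x$ ($x=\ell,c,r$) stays weakly above the line $y=\frac{a+2b}{3}x$.
   Context: A $(3,n)$-parking function $\pi$ is a north/east lattice path from $(0,0)$ to $(3,n)$ weakly above $y=\frac n3x$ whose $n$ north steps are labeled bijectively by $1,\dots,n$ (cars, in the cells just right of the north steps), increasing upward in each column. With $d=\gcd(3,n)$, the cell with lower-left corner $(x,y)$ has rank $3y-nx+\lfloor xd/3\rfloor$; a car's rank is that of its cell. $\mathrm{ides}(\pi)=\{i:\mathrm{rank}(i)<\mathrm{rank}(i+1)\}=\{i_1<\dots<i_r\}$, $\mathrm{pides}(\pi)=(i_1,i_2-i_1,\dots,n-i_r)$; $2^a1^b$ is the composition with $a$ parts $2$ followed by $b$ parts $1$. The three columns are called $\ell,c,r$ (left to right). If $\mathrm{pides}(\pi)=2^a1^b$, then for $i=1,\dots,a$ the cars $2i-1,2i$ (''pair $i$'') lie in two distinct columns, and its placement type is $L$ if these columns are $\{\ell,c\}$, $R$ if $\{c,r\}$, $C$ if $\{\ell,r\}$; the singleton car $2a+s$ ($s=1,\dots,b$) has type $L$, $C$, $R$ if it lies in column $\ell$, $c$, $r$ respectively. Let $p_1,\dots,p_a$ be the types of pairs $1,\dots,a$ and $p_{a+1},\dots,p_{a+b}$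 the types of singletons $2a+1,\dots,2a+b$. The switch map: consider the $b$ pairs $(2i-1,2i)$, $i=1,\dots,b$, and the $a$ singletons $2b+1,\dots,2b+a$, listed as objects $1,\dots,a+b$ (pairs first); give object $j$ the type $p_{a+b+1-j}$; a pair of type $L$/$R$/$C$ puts one car in each of the columns $\{\ell,c\}$/$\{c,r\}$/$\{\ell,r\}$, a singleton of type $L$/$C$/$R$ goes to column $\ell$/$c$/$r$. $\mathbb{S}(\pi)$ is the resulting labeling of the $3\times(a+2b)$ grid, with the cars in each column stacked in increasing order upward and the column heights equal to the number of cars assigned to each column. *)

(* Defs.v *)
From mathcomp Require Import all_boot all_order all_algebra.

Set Implicit Arguments.
Unset Strict Implicit.
Unset Printing Implicit Defensive.

Definition step := bool.
Definition North : step := true.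
Definition East : step := false.

(* The j-th entry of [labels] (from 0) labels the j-th north step of [steps],
   which is the one going from height j to height j+1. *)
Record labeled_path := LabeledPath { steps : seq step; labels : seq nat }.

(* The abscissas of the north steps, from bottom to top, of a path whose
   starting point has abscissa x. *)
Fixpoint north_cols (x : nat) (s : seq step) : seq nat :=
  if s is st :: s' then
    if st == North then x :: north_cols x s' else north_cols x.+1 s'
  else [::].

(* Half-planes are convex, so it is enough to look at the lattice points
   (number of east steps, number of north steps) visited by the path. *)
Definition weakly_above (n : nat) (s : seq step) : Prop :=
  forall k, k <= size s ->
    n * count_mem East (take k s) <= 3 * count_mem North (take k s).

Definition column_increasing (p : labeled_path) : Prop :=
  forall i j, i < j < size (labels p) ->
    nth 0 (north_cols 0 (steps p)) i = nth 0 (north_cols 0 (steps p)) j ->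
    nth 0 (labels p) i < nth 0 (labels p) j.

Definition parking_function (n : nat) (p : labeled_path) : Prop :=
  [/\ count_mem North (steps p) = n /\ count_mem East (steps p) = 3,
      weakly_above n (steps p),
      perm_eq (labels p) (iota 1 n)
    & column_increasing p].

(* Coordinates of the lower-left corner of the cell of car k. *)
Definition car_y (p : labeled_path) (k : nat) : nat := index k (labels p).
Definition car_x (p : labeled_path) (k : nat) : nat :=
  nth 0 (north_cols 0 (steps p)) (car_y p k).

Definition rank (n : nat) (p : labeled_path) (k : nat) : int :=
  ((3 * car_y p k)%N%:Z - (n * car_x p k)%N%:Z
   + (car_x p k * gcdn 3 n %/ 3)%N%:Z)%R.

Definition ides (n : nat) (p : labeled_path) : seq nat :=
  [seq i <- iota 1 n.-1 | (rank n p i < rank n p i.+1)%R].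

(* The successive differences of 0, i_1, ..., i_r, n. *)
Definition pides (n : nat) (p : labeled_path) : seq nat :=
  pairmap (fun x y => y - x) 0 (rcons (ides n p) n).

Definition twos_ones (a b : nat) : seq nat := nseq a 2 ++ nseq b 1.

Definition col_l : nat := 0.
Definition col_c : nat := 1.
Definition col_r : nat := 2.

Inductive placement := L | C | R.

Definition pair_cols (t : placement) : seq nat :=
  match t with
  | L => [:: col_l; col_c]
  | R => [:: col_c; col_r]
  | C => [:: col_l; col_r]
  end.

Definition single_col (t : placement) : nat :=
  match t with L => col_l | C => col_c | R => col_r end.

(* Only meaningful when x and y are two distinct columns. *)
Definition pair_type (x y : nat) : placement :=
  if perm_eq [:: x; y] (pair_cols L) then L
  else if perm_eq [:: x; y] (pair_cols R) then R
  else C.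

(* Only meaningful when x is a column. *)
Definition single_type (x : nat) : placement :=
  if x == single_col L then L else if x == single_col C then C else R.

(* p_1, ..., p_{a+b}. *)
Definition types (a b : nat) (p : labeled_path) : seq placement :=
  [seq pair_type (car_x p (2 * i).-1) (car_x p (2 * i)) | i <- iota 1 a]
  ++ [seq single_type (car_x p (2 * a + s)) | s <- iota 1 b].

(* [col] sends each car 1, ..., 2b+a to its column under the switch map; the
   rule does not say which of the two cars of a pair goes to which of its two
   columns, so [col] is constrained but not determined. The j-th object gets
   the (j-1)-st entry, counted from 0, of the reversed list of types. *)
Definition switch_placement (a b : nat) (p : labeled_path) (col : nat -> nat)
    : Prop :=
  let q := rev (types a b p) in
  (forall j, 1 <= j <= b ->
     perm_eq [:: col (2 * j).-1; col (2 * j)] (pair_cols (nth L q j.-1))) /\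
  (forall s, 1 <= s <= a ->
     col (2 * b + s) = single_col (nth L q (b + s).-1)).

Definition cars_in (N : nat) (col : nat -> nat) (x : nat) : seq nat :=
  [seq k <- iota 1 N | col k == x].

Definition stacked_path (N : nat) (col : nat -> nat) : labeled_path :=
  LabeledPath
    (flatten [seq rcons (nseq (size (cars_in N col x)) North) East
             | x <- [:: col_l; col_c; col_r]])
    (flatten [seq cars_in N col x | x <- [:: col_l; col_c; col_r]]).

(* A labeled path is an image of [p] under the switch map, for one of the
   possible distributions of the cars of each pair over its two columns. *)
Definition is_switch (a b : nat) (p sigma : labeled_path) : Prop :=
  exists2 col, switch_placement a b p col & sigma = stacked_path (a + 2 * b) col.

Lemma is_switch_exists (a b : nat) (p : labeled_path) :
  exists sigma, is_switch a b p sigma.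
Proof.
pose q := rev (types a b p).
pose col k := if k <= 2 * b
  then nth 0 (pair_cols (nth L q (uphalf k).-1)) (~~ odd k)
  else single_col (nth L q (k - b).-1).
exists (stacked_path (a + 2 * b) col); exists col => //; split.
- case=> // j /andP[_ jb]; rewrite /col.
  have -> : (2 * j.+1).-1 = j.*2.+1 by rewrite mul2n doubleS.
  have -> : 2 * j.+1 = j.+1.*2 by rewrite mul2n.
  have -> : 2 * b = b.*2 by rewrite mul2n.
  rewrite leq_double ltn_double jb /= !odd_double /= uphalf_double doubleK -/q.
  by case: (nth L q j).
- move=> s /andP[s1 _]; rewrite /col leqNgt -{1}(addn0 (2 * b)) ltn_add2l s1 /=.
  by rewrite mul2n -addnn -addnA addKn -/q.
Qed.

(* Main.v *)
(* Only the heights of the columns matter. Both for pairs and for singletons, the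
   number of cars left of a given column is determined by u(t) = [t is L or C]
   and v(t) = [t is L]: a pair of type t has u(t) cars in column l and
   1 + v(t) in columns l and c, a singleton v(t) and u(t). With U, V the sums of
   u, v over the pairs and U', V' over the singletons, the path of pi is above
   the line iff n <= 3 (U + V') and 2n <= 3 (a + V + U'). The switch exchanges
   (a, U, V) with (b, U', V'), and since n = 2a + b, each of the two
   inequalities for pi becomes the other one for the switched path. *)
Require Import Defs.
From mathcomp Require Import all_boot all_order all_algebra.
From mathcomp Require Import zify.

(** * Lattice paths and column heights *)

Lemma all_leq_north_cols (x : nat) (s : seq step) :
  all (leq x) (north_cols x s).
Proof.
elim: s x => [|[] s IH] x //=; first by rewrite leqnn IH.
by apply: sub_all (IH x.+1) => c /ltnW.
Qed.

(** A north step strictly left of the point reached after [k] steps has already been taken. *)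
Lemma count_take_north_cols (s : seq step) (x k : nat) :
  count (fun c => c < x + count_mem East (take k s)) (north_cols x s)
    <= count_mem North (take k s).
Proof.
elim: k s x => [|k IH] s x.
  rewrite take0 addn0 leqn0 -leqn0 leqNgt -has_count -all_predC.
  by apply: sub_all (all_leq_north_cols x s) => c /=; rewrite -leqNgt.
case: s => [|[] s] //=.
  by rewrite add0n leq_add ?leq_b1.
by have := IH s x.+1; rewrite addSnnS.
Qed.

(** The witness is the shortest prefix with [j] east steps: it ends at the lowest point of its
    abscissa, where no north step of the next column has been taken. *)
Lemma take_north_cols_witness (s : seq step) (x j : nat) :
  j <= count_mem East s ->
  exists k, [/\ k <= size s, count_mem East (take k s) = j
    & count_mem North (take k s) <= count (fun c => c < x + j) (north_cols x s)].
Proof.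
elim: s x j => [|st s IH] x j /=; first by rewrite leqn0 => /eqP->; exists 0.
case: j => [|j]; first by exists 0.
case: st => /= jE.
  have [k [ks kE kN]] := IH x j.+1 jE.
  exists k.+1; split => //=.
  by rewrite -[x in x < _]addn0 ltn_add2l leq_add2l.
have [k [ks kE kN]] := IH x.+1 j jE.
exists k.+1; split => //=; first by rewrite kE.
by rewrite add0n addnS -addSn.
Qed.

(** On each vertical line only the lowest point of the path matters, and its height is the number of
    north steps in the columns to its left. *)
Lemma weakly_aboveP (n : nat) (s : seq step) :
  weakly_above n s <->
  (forall j, j <= count_mem East s ->
     n * j <= 3 * count (fun c => c < j) (north_cols 0 s)).
Proof.
split=> [above j jE | heights k _].
  have [k [ks kE kN]] := take_north_cols_witness s 0 j jE.
  by have := above k ks; rewrite kE => /leq_trans; apply; rewrite leq_mul2l.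
apply: leq_trans (heights _ _) _; last by rewrite leq_mul2l (count_take_north_cols s 0).
by rewrite -[s in _ <= count _ s](cat_take_drop k) count_cat leq_addr.
Qed.

Lemma size_north_cols (x : nat) (s : seq step) :
  size (north_cols x s) = count_mem North s.
Proof. by elim: s x => [|[] s IH] x //=; rewrite IH. Qed.

(** * Columns of the cars of a parking function *)

Section ParkingFunction.

Variables (n : nat) (p : labeled_path).
Hypothesis pf : parking_function n p.

Lemma size_labels : size (labels p) = n.
Proof. by case: pf => _ _ /perm_size->; rewrite size_iota. Qed.

Lemma uniq_labels : uniq (labels p).
Proof. by case: pf => _ _ /perm_uniq->; rewrite iota_uniq. Qed.

Lemma mem_labels (k : nat) : (k \in labels p) = (0 < k <= n).
Proof. by case: pf => _ _ /perm_mem->; rewrite mem_iota add1n ltnS. Qed.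

Lemma map_car_x : perm_eq (map (car_x p) (iota 1 n)) (north_cols 0 (steps p)).
Proof.
case: (pf) => [[nN _] _ /(perm_map (car_x p)) + _]; rewrite perm_sym.
move/perm_trans; apply; rewrite (_ : map _ _ = north_cols 0 (steps p)) //.
apply: (@eq_from_nth _ 0); first by rewrite size_map size_labels size_north_cols.
move=> i; rewrite size_map => ip.
by rewrite (nth_map 0) // /car_x /car_y index_uniq // uniq_labels.
Qed.

(** The line has height [n] at abscissa 3, so all [n] north steps precede the third east step. *)
Lemma car_x_lt3 (k : nat) : 0 < k <= n -> car_x p k < 3.
Proof.
move=> kn; case: (pf) => [[nN nE] /weakly_aboveP/(_ 3) + _ _].
rewrite nE mulnC leq_mul2l /= => /(_ isT) le_n.
have: all (fun c => c < 3) (north_cols 0 (steps p)).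
  by rewrite all_count eqn_leq count_size size_north_cols nN le_n.
rewrite -(perm_all _ map_car_x) => /allP; apply; apply: map_f.
by rewrite mem_iota add1n ltnS.
Qed.

(** Within a column, ranks are ordered as heights and labels increase upward, so [k] and [k.+1]
    sharing a column would put [k] in [ides]. *)
Lemma car_x_descent (k : nat) :
  0 < k < n -> k \notin ides n p -> car_x p k != car_x p k.+1.
Proof.
move=> /andP[k0 kn]; rewrite mem_filter (_ : k \in _); last by rewrite mem_iota; lia.
rewrite andbT; apply: contra => /eqP eq_x.
have kp : k \in labels p by rewrite mem_labels k0 ltnW.
have k1p : k.+1 \in labels p by rewrite mem_labels.
rewrite /rank eq_x; case: (ltngtP (car_y p k) (car_y p k.+1)) => [|lt_y|eq_y].
- lia.
- case: pf => _ _ _ /(_ (car_y p k.+1) (car_y p k)).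
  rewrite lt_y index_mem kp /car_y !nth_index // -/(car_x _ _).
  by move=> /(_ isT (esym eq_x)); rewrite ltnNge leqnSn.
- by have := congr1 (nth 0 (labels p)) eq_y; rewrite /car_y !nth_index // => /n_Sn.
Qed.

End ParkingFunction.

(** * Partial sums of the composition *)

Lemma pairmap_sub_twos_ones (x a b : nat) (s : seq nat) :
  path ltn x s -> pairmap (fun u v => v - u) x s = twos_ones a b ->
  last x s = x + (2 * a + b) /\ (forall i, i < a -> (x + 2 * i).+1 \notin s).
Proof.
elim: a x s => [|a IH] x s.
  move=> xs eq_s; split=> //; elim: b x s xs eq_s => [|b IHb] x [|y s] //=.
     by rewrite !addn0.
  by case/andP=> xy ys [yx /(IHb _ _ ys)->]; lia.
case: s => [|y s] //= /andP[xy ys] [yx /(IH _ _ ys)[-> notin]].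
have def_y : y = x.+2 by lia.
subst y.
split; first by lia.
case=> [_|i lt_i].
  rewrite inE negb_or muln0 addn0 neq_ltn leqnn /=.
  by apply/negP => /(allP (order_path_min ltn_trans ys)) /=; lia.
rewrite inE negb_or (_ : (x + 2 * i.+1).+1 = (x.+2 + 2 * i).+1); last by lia.
by rewrite notin // andbT; lia.
Qed.

(** The partial sums of the composition are 2, 4, ..., 2a and then every integer up to [n], so the
    odd numbers below 2a are skipped. *)
Lemma pides_twos_ones (n a b : nat) (p : labeled_path) :
  0 < n -> pides n p = twos_ones a b ->
  n = 2 * a + b /\ (forall i, i < a -> (2 * i).+1 \notin ides n p).
Proof.
move=> n0; case/pairmap_sub_twos_ones=> [|last_n notin].
  have ides_bound i : i \in ides n p -> 0 < i < n.
    by rewrite mem_filter mem_iota => /andP[_]; lia.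
  rewrite (path_sortedE ltn_trans) all_rcons n0 /=; apply/andP; split.
    by apply/allP => i /ides_bound/andP[].
  rewrite (sorted_pairwise ltn_trans) pairwise_rcons -(sorted_pairwise ltn_trans).
  rewrite (sorted_filter ltn_trans) ?iota_ltn_sorted // andbT.
  by apply/allP => i /ides_bound/andP[].
rewrite last_rcons in last_n; split=> // i /notin.
by rewrite mem_rcons inE negb_or => /andP[].
Qed.

(** * Columns occupied by pairs and singletons of given types *)

Lemma pair_columns (m : nat) (col : nat -> nat) (q : seq placement) :
  (forall i, i < size q ->
     perm_eq [:: col (m + 2 * i); col (m + 2 * i).+1] (pair_cols (nth L q i))) ->
  perm_eq (map col (iota m (2 * size q))) (flatten (map pair_cols q)).
Proof.
elim: q m => // t q IH m colP; rewrite [size _]/= mulnS iotaD map_cat.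
apply: perm_cat; first by have := colP 0 isT; rewrite muln0 addn0.
by apply: IH => i /(colP i.+1) /=; rewrite mulnS addnA addn2.
Qed.

Definition object_cols (pairs singles : seq placement) : seq nat :=
  flatten (map pair_cols pairs) ++ map single_col singles.

Lemma placement_columns (a b : nat) (col : nat -> nat) (q1 q2 : seq placement) :
  size q1 = a -> size q2 = b ->
  (forall i, i < a ->
     perm_eq [:: col (2 * i).+1; col (2 * i).+2] (pair_cols (nth L q1 i))) ->
  (forall s, s < b -> col (2 * a + s).+1 = single_col (nth L q2 s)) ->
  perm_eq (map col (iota 1 (2 * a + b))) (object_cols q1 q2).
Proof.
move=> <- <- pairs singles; rewrite iotaD map_cat.
apply: perm_cat; first exact: pair_columns.
rewrite (_ : map col _ = map single_col q2) //.
apply: (@eq_from_nth _ 0); rewrite ?size_map size_iota // => i lt_i.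
by rewrite !(nth_map 0) ?(nth_map L) ?size_iota // nth_iota // -addnA singles.
Qed.

Lemma pair_typeP (x y : nat) :
  x < 3 -> y < 3 -> x != y -> perm_eq [:: x; y] (pair_cols (pair_type x y)).
Proof. by case: x y => [|[|[|]]] // [|[|[|]]]. Qed.

Lemma single_typeP (x : nat) : x < 3 -> x = single_col (single_type x).
Proof. by case: x => [|[|[|]]]. Qed.

(** The tests [single_col t < 2] and [single_col t < 1] are u(t) and v(t), so the height is U +
    V'. *)
Lemma count1_object_cols (pairs singles : seq placement) :
  count (fun c => c < 1) (object_cols pairs singles)
  = count (fun t => single_col t < 2) pairs + count (fun t => single_col t < 1) singles.
Proof.
rewrite count_cat count_map; congr (_ + _).
by elim: pairs => //= t s IH; rewrite count_cat IH; case: t.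
Qed.

(** In the same notation, the height is a + V + U'. *)
Lemma count2_object_cols (pairs singles : seq placement) :
  count (fun c => c < 2) (object_cols pairs singles)
  = size pairs + count (fun t => single_col t < 1) pairs
    + count (fun t => single_col t < 2) singles.
Proof.
rewrite count_cat count_map; congr (_ + _).
by elim: pairs => //= t s IH; rewrite count_cat IH; case: t => /=; lia.
Qed.

Lemma size_object_cols (pairs singles : seq placement) :
  size (object_cols pairs singles) = 2 * size pairs + size singles.
Proof.
rewrite size_cat size_map; congr (_ + _).
by elim: pairs => //= t s IH; rewrite size_cat IH mulnS; case: t.
Qed.

Lemma object_cols_lt3 (pairs singles : seq placement) :
  all (fun c => c < 3) (object_cols pairs singles).
Proof.
rewrite all_cat all_map; apply/andP; split; last by elim: singles => //= -[].
by elim: pairs => //= t s IH; rewrite all_cat IH; case: t.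
Qed.

(** * The path with stacked columns *)

Lemma north_cols_cat (x : nat) (s t : seq step) :
  north_cols x (s ++ t) = north_cols x s ++ north_cols (x + count_mem East s) t.
Proof.
elim: s x => [|[] s IH] x /=; first by rewrite addn0.
  by rewrite IH add0n.
by rewrite IH addSnnS.
Qed.

Section StackedPath.

Variables (N : nat) (col : nat -> nat).
Hypothesis col_lt3 : all (fun c => c < 3) (map col (iota 1 N)).

Lemma map_col_cars_in (x : nat) :
  map col (cars_in N col x) = nseq (size (cars_in N col x)) x.
Proof.
rewrite /cars_in; elim: (iota 1 N) => //= k s IH.
by case: eqP => //= ->; rewrite IH.
Qed.

Lemma north_cols_stacked_path :
  north_cols 0 (steps (stacked_path N col)) = map col (labels (stacked_path N col)).
Proof.
have column y k : north_cols y (rcons (nseq k North) East) = nseq k y.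
  by elim: k => //= k ->.
have easts k : count_mem East (rcons (nseq k North) East) = 1.
  by elim: k => //= k ->.
by rewrite /= !north_cols_cat !column !easts !map_cat !map_col_cars_in.
Qed.

Lemma perm_labels_stacked_path :
  perm_eq (labels (stacked_path N col)) (iota 1 N).
Proof.
apply/permP => P; rewrite /= cats0 !count_cat /cars_in.
elim: (iota 1 N) col_lt3 => //= k s IH /andP[+ /IH<-].
by case: (col k) => [|[|[|]]] //= _; lia.
Qed.

Lemma column_increasing_stacked_path : column_increasing (stacked_path N col).
Proof.
move=> i j ij; rewrite north_cols_stacked_path.
(* This relation is vacuous between different columns, so it can be checked block by block on the
   concatenated labels. *)
pose r k l := (col k == col l) ==> (k < l).
have column x : pairwise r (cars_in N col x).
  have : pairwise ltn (cars_in N col x).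
    by rewrite -sorted_pairwise ?sorted_filter ?iota_ltn_sorted //; exact: ltn_trans.
  by apply: sub_pairwise => k l /= kl; rewrite /r kl implybT.
have apart x y : x != y -> allrel r (cars_in N col x) (cars_in N col y).
  move=> xy; apply/allrelP => k l; rewrite !mem_filter => /andP[/eqP kx _] /andP[/eqP ly _].
  by rewrite /r kx ly (negbTE xy).
have: pairwise r (labels (stacked_path N col)).
  by rewrite /= cats0 !pairwise_cat !allrel_catr !column !apart.
case/andP: ij => lt_ij lt_j; have lt_i := ltn_trans lt_ij lt_j.
move/(pairwiseP 0)/(_ i j lt_i lt_j lt_ij).
by rewrite !(nth_map 0) // => /implyP rij /eqP/rij.
Qed.

Lemma parking_stacked_path :
  (forall j, j <= 3 -> N * j <= 3 * count (fun c => c < j) (map col (iota 1 N))) ->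
  parking_function N (stacked_path N col).
Proof.
move=> heights.
have nE : count_mem East (steps (stacked_path N col)) = 3.
  by rewrite /= -!cats1 !count_cat !count_nseq.
split; last exact: column_increasing_stacked_path.
- split=> //; rewrite -(size_north_cols 0) north_cols_stacked_path size_map.
  by rewrite (perm_size perm_labels_stacked_path) size_iota.
- apply/weakly_aboveP => j; rewrite nE north_cols_stacked_path => /heights.
  by rewrite (permP (perm_map col perm_labels_stacked_path)).
- exact: perm_labels_stacked_path.
Qed.

End StackedPath.

(** * Types of a parking function and the switch *)

Lemma car_x_object_cols (n a b : nat) (p : labeled_path) :
  0 < n -> parking_function n p -> pides n p = twos_ones a b ->
  exists t1 t2, [/\ size t1 = a, size t2 = b, types a b p = t1 ++ t2
    & perm_eq (map (car_x p) (iota 1 n)) (object_cols t1 t2)].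
Proof.
move=> n0 pf /(pides_twos_ones _ _ _ _ n0)[def_n notin].
rewrite /types; set t1 := map _ (iota 1 a); set t2 := map _ (iota 1 b).
have sz1 : size t1 = a by rewrite size_map size_iota.
have sz2 : size t2 = b by rewrite size_map size_iota.
exists t1, t2; split=> //; rewrite def_n; apply: placement_columns => // [i|s] lt.
  rewrite (nth_map 0) ?size_iota // nth_iota // add1n mulnS.
  (* The smaller car of a pair is not in [ides], so the two cars lie in distinct columns, where
     [pair_type] is meaningful. *)
  by apply: pair_typeP; rewrite ?(car_x_lt3 _ _ pf) ?(car_x_descent _ _ pf) ?notin //; lia.
rewrite (nth_map 0) ?size_iota // nth_iota // add1n addnS.
by apply: single_typeP; rewrite (car_x_lt3 _ _ pf) //; lia.
Qed.

Theorem theorem11 (n a b : nat) (pi sigma : labeled_path)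
  (hn : 0 < n)
  (hpi : parking_function n pi)
  (hpides : pides n pi = twos_ones a b)
  (hsigma : is_switch a b pi sigma) :
  parking_function (a + 2 * b) sigma.
Proof.
have [t1 [t2 [sz1 sz2 def_types pi_cols]]] := car_x_object_cols _ _ _ _ hn hpi hpides.
have [def_n _] := pides_twos_ones _ _ _ _ hn hpides.
case: hsigma => col; rewrite /switch_placement def_types rev_cat => -[pairs singles] ->.
(* Reversing the whole list of types hands the singleton types [t2] to the new pairs and the pair
   types [t1] to the new singletons. *)
have sigma_cols : perm_eq (map col (iota 1 (a + 2 * b))) (object_cols (rev t2) (rev t1)).
  rewrite addnC; apply: placement_columns; rewrite ?size_rev // => i lt_i.
    have := pairs i.+1 lt_i.
    by rewrite mulnS nth_cat size_rev sz2 lt_i.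
  have := singles i.+1 lt_i.
  by rewrite !addnS nth_cat size_rev sz2 ltnNge leq_addr addKn.
have pi_height j : j <= 3 -> n * j <= 3 * count (fun c => c < j) (object_cols t1 t2).
  case: (hpi) => [[_ nE] /weakly_aboveP + _ _] le_j; rewrite nE => /(_ j le_j).
  by rewrite -(permP (map_car_x _ _ hpi)) (permP pi_cols).
apply: parking_stacked_path; first by rewrite (perm_all _ sigma_cols) object_cols_lt3.
move=> j; rewrite (permP sigma_cols).
case: j => [|[|[|[|]]]] // _; first by rewrite muln0.
(* Removing 3a from both sides of 2n <= 3(a + V + U') leaves a + 2b <= 3(U' + V). *)
- have := pi_height 2 isT; rewrite count1_object_cols count2_object_cols !count_rev.
  lia.
(* Adding 3b to both sides of n <= 3(U + V') gives 2(a + 2b) <= 3(b + V' + U). *)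
- have := pi_height 1 isT; rewrite count1_object_cols count2_object_cols !count_rev size_rev.
  lia.
- have := object_cols_lt3 (rev t2) (rev t1); rewrite all_count => /eqP->.
  by rewrite size_object_cols !size_rev sz1 sz2; lia.
Qed.
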